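(* Let $n$ be a positive integer and $1\le k\le n$. Let $p=(p_1,\dots,p_n)\in\mathbb{R}^n$, $q=(q_1,\dots,q_n)\in\mathbb{R}^n$ and $\beta\in\mathbb{R}$, and let $M$ be the $n\times n$ matrix $$M=\big(p_i\delta_{ij}-\beta q_iq_j\big)_{n\times n}.$$ Then $$\sigma_k(\lambda(M))=\sigma_k(p)-\beta\sum_{i=1}^n q_i^2\,\sigma_{k-1;i}(p).$$
   Context: For $\lambda\in\mathbb{R}^n$, $\sigma_k(\lambda)=\sum_{1\le i_1<\cdots<i_k\le n}\lambda_{i_1}\cdots\lambda_{i_k}$ is the $k$-th elementary symmetric function, with $\sigma_0=1$; $\lambda(M)$ denotes the eigenvalues of the symmetric matrix $M$, and $\delta_{ij}$ is the Kronecker delta. $\sigma_{k-1;i}(p)=\sigma_{k-1}(p)|_{p_i=0}$ is the $(k-1)$-th elementary symmetric function evaluated at $p$ with its $i$-th entry replaced by $0$ (so $\sigma_{0;i}=1$). *)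

(* Defs.v *)
From mathcomp Require Import all_boot all_order all_algebra.
From mathcomp Require Import mpoly.
From mathcomp Require Import polyrcf complex.

Set Implicit Arguments.
Unset Strict Implicit.
Unset Printing Implicit Defensive.

Import Order.TTheory GRing.Theory Num.Theory.
Local Open Scope ring_scope.

Definition sigma (R : comNzRingType) (n k : nat) (v : 'rV[R]_n) : R :=
  (mesym n R k).@[fun i => v 0 i].

(* [sigma_at0 k i v] is sigma_{k;i}(v): the i-th entry of v is replaced by 0,
   not deleted, so the vector still has n entries. *)
Definition sigma_at0 (R : comNzRingType) (n k : nat) (i : 'I_n)
    (v : 'rV[R]_n) : R :=
  sigma k (\row_j (if j == i then 0 else v 0 j)).

(* [rootsR] lists each real root once, hence the repetition by multiplicity. *)
Definition eigenvalue_seq (R : rcfType) (n : nat) (M : 'M[R]_n) : seq R :=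
  flatten [seq nseq (mup x (char_poly M)) x | x <- rootsR (char_poly M)].

(* The eigenvalues of M as a vector of R^n, in increasing order.  For symmetric
   M the sequence has exactly n terms ([size_eigenvalue_seq]), so the default
   value 0 of [nth] is never used. *)
Definition eigenvalues (R : rcfType) (n : nat) (M : 'M[R]_n) : 'rV[R]_n :=
  \row_(i < n) (eigenvalue_seq M)`_i.

Lemma char_poly_sym_split (R : rcfType) (n : nat) (M : 'M[R]_n) :
  M^T = M -> exists d : 'rV[R]_n, char_poly M = \prod_i ('X - (d 0 i)%:P).
Proof.
move=> symM; pose A := map_mx (real_complex R) M.
have rA : A \is a mxOver Num.real.
  by apply/mxOverP => i j; rewrite mxE complex_real.
have hA : A \is hermsymmx.
  apply: realsym_hermsym => //; apply/is_hermitianmxP.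
  by rewrite expr0 scale1r map_mx_id // /A -[in LHS]symM map_trmx.
have /orthomx_spectralP eA := hermitian_normalmx hA.
have /mxOverP rd := hermitian_spectral_diag_real hA.
set d := spectral_diag A in eA rd; set P := spectralmx A in eA.
have uP : P \in unitmx := spectral_unit A.
exists (map_mx (@complex.Re R) d).
apply: (map_poly_inj (real_complex R)).
rewrite map_char_poly -/A rmorph_prod /=.
have -> : char_poly A = char_poly (diag_mx d).
  rewrite eA /char_poly; set D := diag_mx d.
  have VP : map_mx polyC (invmx P) *m map_mx polyC P = 1%:M.
    by rewrite -map_mxM mulVmx // map_mx1.
  have -> : char_poly_mx (invmx P *m D *m P) =
      map_mx polyC (invmx P) *m char_poly_mx D *m map_mx polyC P.
    rewrite /char_poly_mx !map_mxM mulmxBr mulmxBl scalar_mxC.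
    by rewrite -(mulmxA 'X%:M) VP mulmx1.
  by rewrite !det_mulmx mulrAC -det_mulmx VP det1 mul1r.
rewrite char_poly_trig ?diag_mx_is_trig //.
apply: eq_bigr => i _.
rewrite rmorphB /= map_polyX map_polyC /= !mxE eqxx mulr1n.
by rewrite -[in LHS](RRe_real (rd 0 i)).
Qed.

Lemma eigenvalue_seq_split (R : rcfType) (n : nat) (M : 'M[R]_n) :
  M^T = M -> char_poly M = \prod_(x <- eigenvalue_seq M) ('X - x%:P).
Proof.
move=> /char_poly_sym_split [d eM].
pose s := [seq d 0 i | i <- enum 'I_n].
have eMs : char_poly M = \prod_(x <- s) ('X - x%:P).
  by rewrite eM big_map big_enum.
rewrite {1}eMs; apply: perm_big; rewrite perm_sym; apply/allP => x _ /=; apply/eqP.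
have p0 : char_poly M != 0 by rewrite monic_neq0 // char_poly_monic.
rewrite -(mu_prod_XsubC x s) -eMs /eigenvalue_seq count_flatten -map_comp.
rewrite sumnE big_map.
under eq_bigr do rewrite /= count_nseq /=.
have rP : (x \in rootsR (char_poly M)) = root (char_poly M) x.
  by rewrite -roots_on_rootsR // in_itv.
have uR : uniq (rootsR (char_poly M)) := uniq_roots _ _ _.
case: (boolP (root (char_poly M) x)) => rx; last first.
  rewrite (mupNroot rx) big1_seq // => y /andP[_ yr].
  case: eqP => [exy|_]; last by rewrite mul0n.
  by move: rx; rewrite -rP -exy yr.
rewrite (bigD1_seq x) ?rP //= eqxx mul1n big1 ?addn0 // => y /negPf yx.
by rewrite yx mul0n.
Qed.

Lemma size_eigenvalue_seq (R : rcfType) (n : nat) (M : 'M[R]_n) :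
  M^T = M -> size (eigenvalue_seq M) = n.
Proof.
move=> /eigenvalue_seq_split /(congr1 (fun p : {poly R} => size p)).
by rewrite size_char_poly size_prod_XsubC => -[].
Qed.

(* Main.v *)
Require Import Defs.
From mathcomp Require Import all_boot all_order all_algebra.
From mathcomp Require Import mpoly.

Set Implicit Arguments.
Unset Strict Implicit.
Unset Printing Implicit Defensive.

Import GRing.Theory.
Local Open Scope ring_scope.

(** By the matrix determinant lemma for a diagonal matrix plus a rank one
matrix, the characteristic polynomial of M is
  prod_i (X - p_i) + beta * sum_i q_i^2 prod_(j != i) (X - p_j).
By Vieta's formulas the coefficient of X^(n-k) in the characteristic polynomial
is (-1)^k sigma_k(lambda(M)), and multiplying prod_(j != i) (X - p_j) by X
amounts to replacing p_i by 0, so its coefficient of X^(n-k) is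
(-1)^(k-1) sigma_(k-1;i)(p). *)

(** [A + u *m v] is the Schur complement of the corner block 1. *)
Lemma det_block_mx1 (R : comNzRingType) n (A : 'M[R]_n) (u : 'cV_n)
    (v : 'rV_n) :
  \det (block_mx (1%:M : 'M_1) (- v) u A) = \det (A + u *m v).
Proof.
have -> : block_mx (1%:M : 'M_1) (- v) u A =
    block_mx 1%:M 0 u 1%:M *m block_mx 1%:M (- v) 0 (A + u *m v).
  by rewrite mulmx_block !(mul0mx, mul1mx, mulmx0, mulmx1) !addr0 mulmxN addrC addrK.
by rewrite det_mulmx det_lblock det_ublock !det1 !mul1r.
Qed.

(** A lower triangular right factor of determinant [P] makes the bordered matrix of [det_block_mx1]
    upper triangular, with determinant [(P + S) * P]; the nonzero [P] then cancels. *)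
Lemma det_diag_mx_rank1 (R : idomainType) n (d : 'rV[R]_n) (u : 'cV_n)
    (v : 'rV_n) :
    (forall i, d 0 i != 0) ->
  \det (diag_mx d + u *m v) =
    \prod_i d 0 i + \sum_i u i 0 * v 0 i * \prod_(j | j != i) d 0 j.
Proof.
move=> d_neq0; set P := \prod_i d 0 i; set S := \sum_i _.
have P_neq0 : P != 0 by apply/prodf_neq0 => i _; apply: d_neq0.
pose e : 'rV[R]_n := \row_i \prod_(j | j != i) d 0 j.
(* [diag_mx e] plays the role of the adjugate of [diag_mx d]. *)
have clear_u : block_mx (1%:M : 'M_1) (- v) u (diag_mx d) *m
      block_mx P%:M 0 (- (diag_mx e *m u)) 1%:M =
    block_mx (P + S)%:M (- v) 0 (diag_mx d).
  rewrite mulmx_block !(mul1mx, mulmx0, mulmx1) !add0r mulNmx !mulmxN opprK.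
  congr block_mx.
    apply/matrixP => i j; rewrite !ord1 !mxE; congr (_ + _).
    apply: eq_bigr => k _; rewrite mul_diag_mx !mxE.
    by rewrite mulrA mulrAC (mulrC (v 0 k)).
  (* The lower left block vanishes because [d 0 i * e 0 i = P] for every [i]. *)
  apply/matrixP => i j; rewrite [j]ord1 mul_mx_scalar !mul_diag_mx !mxE.
  by rewrite mulrA -(bigD1 i (P := predT)) ?subrr.
apply: (mulIf P_neq0); have := congr1 determinant clear_u.
rewrite det_mulmx det_block_mx1 det_lblock det_ublock det1 mulr1.
by rewrite !det_scalar1 det_diag.
Qed.

Lemma coef_prod_XsubC_sigma (R : idomainType) n k (v : 'rV[R]_n) :
    (k <= n)%N ->
  (\prod_i ('X - (v 0 i)%:P))`_(n - k) = (-1) ^+ k * sigma k v.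
Proof.
move=> le_kn; have := mroots_coeff [tuple v 0 i | i < n] (Ordinal (le_kn : (k < n.+1)%N)).
rewrite big_tuple /sigma /=.
under eq_bigr do rewrite tnth_mktuple.
move=> ->; congr (_ * _); apply: meval_eq => i.
by rewrite tnth_mktuple.
Qed.

Lemma coef_prod_neq_XsubC (R : idomainType) n k (i : 'I_n) (v : 'rV[R]_n) :
    (k < n)%N ->
  (\prod_(j | j != i) ('X - (v 0 j)%:P))`_(n - k.+1) =
    (-1) ^+ k * sigma_at0 k i v.
Proof.
move=> lt_kn; rewrite -coef_prod_XsubC_sigma 1?ltnW// [in RHS](bigD1 i)//= !mxE eqxx subr0.
(* The zeroed entry contributes a factor ['X], which shifts the index by one; [k < n] keeps [n - k]
   away from 0, where the coefficient would vanish. *)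
rewrite coefXM subn_eq0 leqNgt lt_kn /= subnS; congr (polyseq _)`_ _.
by apply: eq_bigr => j /negPf ji; rewrite mxE ji.
Qed.

(** The determinant formula is applied over [{poly R}], where the diagonal entries ['X - p_i] are
    nonzero for every [p]. *)
Lemma char_poly_diag_rank1 (R : idomainType) n (p q : 'rV[R]_n) (b : R) :
  char_poly (\matrix_(i, j) (p 0 i * (i == j)%:R - b * q 0 i * q 0 j)) =
    \prod_i ('X - (p 0 i)%:P) +
    b *: \sum_i q 0 i ^+ 2 *: \prod_(j | j != i) ('X - (p 0 j)%:P).
Proof.
pose d := \row_i ('X - (p 0 i)%:P).
rewrite /char_poly.
have -> : char_poly_mx (\matrix_(i, j) (p 0 i * (i == j)%:R - b * q 0 i * q 0 j))
    = diag_mx d + (\col_i (b * q 0 i)%:P) *m (\row_i (q 0 i)%:P).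
  apply/matrixP => i j; rewrite !mxE big_ord1 !mxE polyCB opprB addrCA addrC.
  rewrite -polyCM; congr (_ + _).
  by case: (i == j); rewrite ?mulr1 ?mulr0 ?polyC0 ?subr0 ?mulr1n.
rewrite det_diag_mx_rank1 => [|i]; last by rewrite mxE polyXsubC_eq0.
congr (_ + _); first by apply: eq_bigr => i _; rewrite mxE.
rewrite scaler_sumr; apply: eq_bigr => i _.
rewrite !mxE -polyCM mul_polyC scalerA mulrA; congr (_ *: _).
by apply: eq_bigr => j _; rewrite mxE.
Qed.

Theorem proposition1p2 (R : rcfType) (n k : nat) (hn : (0 < n)%N)
    (hk1 : (1 <= k)%N) (hkn : (k <= n)%N)
    (p q : 'rV[R]_n) (beta : R) (M : 'M[R]_n)
    (hM : M = \matrix_(i < n, j < n)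
                (p 0 i * (i == j)%:R - beta * q 0 i * q 0 j)) :
  sigma k (eigenvalues M) =
    sigma k p - beta * \sum_(i < n) q 0 i ^+ 2 * sigma_at0 k.-1 i p.
Proof.
have symM : M^T = M.
  apply/matrixP => i j; rewrite hM !mxE mulrAC eq_sym; congr (_ - _).
  by case: eqP => [->|]; rewrite ?mulr0.
have charM : char_poly M = \prod_i ('X - (eigenvalues M 0 i)%:P).
  rewrite [LHS](eigenvalue_seq_split symM) (big_nth 0) size_eigenvalue_seq//.
  by rewrite big_mkord; apply: eq_bigr => i _; rewrite mxE.
(* With this sign the left side is the coefficient of ['X^(n - k)] in [char_poly M]. *)
apply: (@mulfI _ ((-1) ^+ k)); first by rewrite signr_eq0.
rewrite -coef_prod_XsubC_sigma// -charM hM char_poly_diag_rank1.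
rewrite coefD coefZ coef_sum coef_prod_XsubC_sigma// mulrBr; congr (_ + _).
rewrite mulrCA -mulrN; congr (_ * _).
rewrite mulr_sumr -sumrN; apply: eq_bigr => i _.
(* The signs for [k.+1] and [k] differ by -1, which absorbs the minus before [beta]. *)
case: k hk1 hkn => // k _ lt_kn.
by rewrite coefZ coef_prod_neq_XsubC// (exprS (-1)) mulN1r mulNr opprK mulrCA.
Qed.
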